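(* Let $R$ be a commutative ring with $1$ and let $f\in R[\alpha][x]$, written as $f=f_1+\alpha f_2$ with $f_1,f_2\in R[x]$. Then $f$ is a null polynomial on $R[\alpha]$ if and only if $f_1$, $f_1'$ and $f_2$ are null polynomials on $R$.
   Context: For a commutative ring $R$ with $1$, the ring of dual numbers over $R$ is $R[\alpha]=R[x]/(x^2)$, where $\alpha=x+(x^2)$; so every element is uniquely $a+b\alpha$ with $a,b\in R$, and $\alpha^2=0$. Every $f\in R[\alpha][x]$ is uniquely of the form $f_1+\alpha f_2$ with $f_1,f_2\in R[x]$. A polynomial over a ring $A$ (or over a ring of which $A$ is an algebra) is a null polynomial on $A$ if $f(a)=0$ for all $a\in A$. $f'$ denotes the formal derivative of $f$. *)

(* Defs.v *)
From mathcomp Require Import all_boot all_algebra.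
From mathcomp Require Export qpoly.

Set Implicit Arguments.
Unset Strict Implicit.
Unset Printing Implicit Defensive.

Import GRing.Theory Pdiv.CommonRing Pdiv.RingMonic.
Local Open Scope ring_scope.

(* [{poly %/ h}] is the quotient by [mk_monic h], which is [h] itself here since
   'X^2 is monic and nonconstant. *)
Notation "{ 'dual' R }" := {poly %/ ('X^2 : {poly R%type})}
  (at level 0, R at level 200, format "{ 'dual'  R }") : type_scope.

Definition dual_alpha (R : comNzRingType) : {dual R} := 'qX.

Definition dual_const (R : comNzRingType) : R -> {dual R} := qpolyC 'X^2.

Definition null_poly (A : comNzRingType) (f : {poly A}) : Prop :=
  forall a : A, f.[a] = 0.

Definition dual_poly (R : comNzRingType) (f1 f2 : {poly R}) :
    {poly {dual R}} :=
  map_poly (@dual_const R) f1 + dual_alpha R *: map_poly (@dual_const R) f2.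

Section Sanity.

Variable R : comNzRingType.
Implicit Types (a b : R) (u : {dual R}) (f g : {poly R}).

Let mkX2 : mk_monic ('X^2 : {poly R}) = 'X^2.
Proof. by rewrite mk_monic_Xn. Qed.

Lemma dual_alpha_val : dual_alpha R = 'X :> {poly R}.
Proof. by rewrite /dual_alpha qpolyXE ?size_polyXn ?monicXn. Qed.

Lemma dual_alpha_sq : dual_alpha R ^+ 2 = 0.
Proof.
apply: val_inj; rewrite [LHS]poly_of_qpolyX dual_alpha_val.
by rewrite [X in rmodp _ X]mkX2 rmodpp ?monicXn.
Qed.

Lemma dual_val a b :
  dual_const a + dual_alpha R * dual_const b = a%:P + 'X * b%:P :> {poly R}.
Proof.
rewrite poly_of_qpolyD poly_of_qpolyM dual_alpha_val [X in rmodp _ X]mkX2 /=.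
rewrite rmodp_small // size_polyXn ltnS (leq_trans (size_polyMleq _ _)) //.
by rewrite size_polyX /= size_polyC; case: eqP.
Qed.

Lemma dual_eta u :
  u = dual_const (u : {poly R})`_0 + dual_alpha R * dual_const (u : {poly R})`_1.
Proof.
apply: val_inj; rewrite [RHS]dual_val; apply/polyP => i.
rewrite coefD coefC coefXM coefC.
case: i => [|[|i]] /=; rewrite ?addr0 ?add0r //.
by rewrite nth_default // -ltnS (leq_trans (size_mk_monic u)) // mkX2 size_polyXn.
Qed.

Lemma dual_inj a b c d :
  dual_const a + dual_alpha R * dual_const b
    = dual_const c + dual_alpha R * dual_const d -> a = c /\ b = d.
Proof.
move/(congr1 val); rewrite [LHS]dual_val [RHS]dual_val => /polyP e.
by move: (e 0%N) (e 1%N); rewrite !coefD !coefC !coefXM !coefC /= !addr0 !add0r.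
Qed.

Lemma coef_dual_poly f1 f2 i :
  (dual_poly f1 f2)`_i = dual_const f1`_i + dual_alpha R * dual_const f2`_i.
Proof.
have e0 : dual_const (0 : R) = 0 by exact: qpolyC0.
by rewrite coefD coefZ !coef_map_id0.
Qed.

Lemma dual_poly_exists (f : {poly {dual R}}) : exists f1 f2, f = dual_poly f1 f2.
Proof.
pose c k := \poly_(i < size f) ((f`_i : {dual R}) : {poly R})`_k.
exists (c 0%N), (c 1%N); apply/polyP => i; rewrite coef_dual_poly !coef_poly.
case: ltnP => [_|le]; first exact: dual_eta.
have e0 : dual_const (0 : R) = 0 by exact: qpolyC0.
by rewrite nth_default // e0 mulr0 addr0.
Qed.

Lemma dual_poly_inj f1 f2 g1 g2 :
  dual_poly f1 f2 = dual_poly g1 g2 -> f1 = g1 /\ f2 = g2.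
Proof.
move/polyP => e; split; apply/polyP => i; have := e i;
  by rewrite !coef_dual_poly => /dual_inj [].
Qed.

End Sanity.

(* Main.v *)
(** Since [alpha ^+ 2 = 0], the Taylor expansion of [f] at [a] stops after the
    linear term:
      [f (a + b alpha) = f1 a + (b * f1' a + f2 a) alpha].
    The three values on the right vanish for all [a], [b] exactly when the
    left-hand side does: take [b = 0] to isolate [f1] and [f2], then [b = 1]. *)
Require Import Defs.
From mathcomp Require Import all_boot all_algebra ring.
Import GRing.Theory.
Local Open Scope ring_scope.

Lemma horner_addr_sqr0 (A : comNzRingType) (p : {poly A}) (x e : A) :
  e ^+ 2 = 0 -> p.[x + e] = p.[x] + e * p^`().[x].
Proof.
move=> e2; elim/poly_ind: p => [|p c IHp]; first by rewrite deriv0 !horner0 mulr0 addr0.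
rewrite derivD derivC derivM derivX addr0 mulr1 !hornerE IHp.
rewrite -[RHS]addr0 -[X in _ = _ + X](mul0r p^`().[x]) -e2.
ring.
Qed.

Lemma horner_dual_poly (R : comNzRingType) (f1 f2 : {poly R}) (a b : R) :
  (dual_poly f1 f2).[dual_const a + dual_alpha R * dual_const b]
    = dual_const f1.[a] + dual_alpha R * dual_const (b * f1^`().[a] + f2.[a]).
Proof.
have al2 := dual_alpha_sq R.
have e2 : (dual_alpha R * dual_const b) ^+ 2 = 0 by rewrite exprMn al2 mul0r.
rewrite /dual_poly hornerD hornerZ !horner_addr_sqr0 //.
(* Unfolding exposes the ring morphism [qpolyC], which commutes with evaluation and derivation. *)
rewrite /dual_const !deriv_map !horner_map rmorphD rmorphM /=.
rewrite -[RHS]addr0.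
rewrite -[X in _ = _ + X](mul0r (qpolyC 'X^2 b * qpolyC 'X^2 f2^`().[a])) -al2.
ring.
Qed.

Theorem theorem3p5 (R : comNzRingType) (f : {poly {dual R}})
    (f1 f2 : {poly R}) (hf : f = dual_poly f1 f2) :
  null_poly f <-> null_poly f1 /\ null_poly f1^`() /\ null_poly f2.
Proof.
have const0 : dual_const (0 : R) = 0 by exact: qpolyC0.
rewrite {}hf; split=> [nf | [nf1 [ndf1 nf2]] u]; last first.
  by rewrite (dual_eta u) horner_dual_poly nf1 ndf1 nf2 mulr0 addr0 const0 mulr0 addr0.
have coefs0 a b : f1.[a] = 0 /\ b * f1^`().[a] + f2.[a] = 0.
  (* Coordinates are compared with those of [0], both zero. *)
  by apply: dual_inj; rewrite -horner_dual_poly nf const0 mulr0 addr0.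
have nf2 : null_poly f2 by move=> a; case: (coefs0 a 0) => _; rewrite mul0r add0r.
split=> [a|]; first by case: (coefs0 a 0).
by split=> // a; case: (coefs0 a 1) => _; rewrite nf2 mul1r addr0.
Qed.
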